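(* Let $R$ be a semiprime ring, let $I$ be a nonzero ideal of $R$, and let $d:R\to R$ be a multiplicative semiderivation associated with a nonzero epimorphism $g$ of $R$. If $d(x\circ y)=0$ for all $x,y\in I$, then $[x,d(x)]=0$ for all $x\in I$.
   Context: Rings are associative and not assumed unital or commutative; ideals are two-sided. A ring $R$ is semiprime if for $x\in R$, $xRx=0$ implies $x=0$. For $x,y\in R$, $[x,y]=xy-yx$ and $x\circ y=xy+yx$. A mapping $d:R\to R$ (not assumed additive) is a multiplicative semiderivation associated with a function $g:R\to R$ if (i) $d(xy)=d(x)g(y)+xd(y)=d(x)y+g(x)d(y)$ and (ii) $d(g(x))=g(d(x))$ hold for all $x,y\in R$. An epimorphism of $R$ is a surjective ring homomorphism $R\to R$; nonzero means not the zero map. *)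

(* Defs.v *)
From HB Require Import structures.
From mathcomp Require Import all_boot all_algebra.

Set Implicit Arguments.
Unset Strict Implicit.
Unset Printing Implicit Defensive.

Import GRing.Theory.

Local Open Scope ring_scope.

(* MathComp's pzRingType and its descendants all carry a unit, so rings without
   unit are introduced here as a multiplication on a zmodType. *)
HB.mixin Record Zmodule_isRng R of GRing.Zmodule R := {
  rmul : R -> R -> R;
  rmulA : associative rmul;
  rmulDl : left_distributive rmul +%R;
  rmulDr : right_distributive rmul +%R
}.

#[short(type="rngType")]
HB.structure Definition Rng := { R of Zmodule_isRng R & GRing.Zmodule R }.

(* A new symbol, since _ * _ in ring_scope is the product of a ring with unit. *)
Notation "x ** y" := (rmul x y)
  (at level 40, left associativity) : ring_scope.

Section RngDefs.
Variable R : rngType.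
Implicit Types (x y r : R) (I : R -> Prop) (d g : R -> R).

Definition lie x y : R := x ** y - y ** x.

Definition jordan x y : R := x ** y + y ** x.

Definition semiprime : Prop :=
  forall x, (forall r, x ** r ** x = 0) -> x = 0.

Record is_ideal I : Prop := IsIdeal {
  rideal0 : I 0;
  ridealB : forall x y, I x -> I y -> I (x - y);
  ridealMl : forall r x, I x -> I (r ** x);
  ridealMr : forall r x, I x -> I (x ** r)
}.

Definition nonzero_ideal I : Prop := is_ideal I /\ exists2 x, I x & x <> 0.

Record is_epimorphism g : Prop := IsEpimorphism {
  epiB : zmod_morphism g;
  epiM : {morph g : x y / x ** y};
  epi_surj : forall y, exists x, g x = y
}.

Definition nonzero_map g : Prop := exists x, g x <> 0.

(* d is an arbitrary map: additivity is not required. *)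
Record multiplicative_semiderivation d g : Prop := MultSemiderivation {
  semiderMr : forall x y, d (x ** y) = d x ** g y + x ** d y;
  semiderMl : forall x y, d (x ** y) = d x ** y + g x ** d y;
  semider_comm : forall x, d (g x) = g (d x)
}.

End RngDefs.

Arguments semiprime R : clear implicits.

(* Main.v *)
(* For x, y in I one has (x o y) x = x o (y x), so applying d to both sides
   gives (x o y) d(x) = 0.  Replacing y by z y and comparing yields
   [x, z] y d(x) = 0 for all z in R.  Taking z = d(x), the element
   a = [x, d(x)] of I satisfies a I a = 0, hence a = 0 by semiprimeness. *)

Require Import Defs.
From mathcomp Require Import all_boot all_algebra.
Local Open Scope ring_scope.
Import GRing.Theory.

Section RngTheory.
Set Implicit Arguments.
Unset Strict Implicit.
Variable R : rngType.
Implicit Types (a x y z : R) (I : R -> Prop) (d g : R -> R).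

Lemma rmul0l x : 0 ** x = 0.
Proof. by apply: (addrI (0 ** x)); rewrite -rmulDl !addr0. Qed.

Lemma rmul0r x : x ** 0 = 0.
Proof. by apply: (addrI (x ** 0)); rewrite -rmulDr !addr0. Qed.

Lemma rmulNl x y : (- x) ** y = - (x ** y).
Proof. by apply: (addrI (x ** y)); rewrite -rmulDl !subrr rmul0l. Qed.

Lemma rmulNr x y : x ** (- y) = - (x ** y).
Proof. by apply: (addrI (x ** y)); rewrite -rmulDr !subrr rmul0r. Qed.

Lemma rmulBl x y z : (x - y) ** z = x ** z - y ** z.
Proof. by rewrite rmulDl rmulNl. Qed.

Lemma rmulBr x y z : x ** (y - z) = x ** y - x ** z.
Proof. by rewrite rmulDr rmulNr. Qed.

Lemma jordan_mulr x y : jordan x (y ** x) = jordan x y ** x.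
Proof. by rewrite /jordan rmulDl !rmulA. Qed.

(** Semiprimeness is applied twice: [a ** r ** a] vanishes because putting any [s] between two
    copies of it gives [a ** y ** a] with [y = r ** a ** s ** a ** r] in [I]. *)
Lemma semiprime_ideal_eq0 I a : semiprime R -> is_ideal I -> I a ->
  (forall y, I y -> a ** y ** a = 0) -> a = 0.
Proof.
move=> spR idI Ia aIa0; apply: (spR) => r; apply: (spR) => s.
have /aIa0 : I (r ** a ** s ** a ** r).
  by do 3!apply: ridealMr => //; apply: ridealMl.
by rewrite !rmulA.
Qed.

(** When [d] is expanded at [jordan x y ** x], the term containing [g x] has the factor
    [d (jordan x y)], which is zero. *)
Lemma jordan_mul_semider I d g x y : is_ideal I ->
  multiplicative_semiderivation d g ->
  (forall u v, I u -> I v -> d (jordan u v) = 0) ->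
  I x -> I y -> jordan x y ** d x = 0.
Proof.
move=> idI hd d0 Ix Iy.
have := d0 x (y ** x) Ix (ridealMr idI x Iy).
by rewrite jordan_mulr (semiderMr hd) d0 // rmul0l add0r.
Qed.

Lemma lie_mul_annihilator I a x : is_ideal I ->
  (forall y, I y -> jordan x y ** a = 0) ->
  forall z y, I y -> lie x z ** y ** a = 0.
Proof.
move=> idI xa0 z y Iy.
(* In front of [a], [x] anticommutes with [I]; taking [v] to be [z ** y], then [y], turns both terms
   of the commutator into [- (z ** y ** x ** a)]. *)
have xya v : I v -> x ** v ** a = - (v ** x ** a).
  by move=> /xa0; rewrite /jordan rmulDl => /eqP; rewrite addr_eq0 => /eqP.
rewrite /lie !rmulBl -(rmulA x z y) xya; last exact: ridealMl.
have -> : z ** x ** y ** a = z ** (x ** y ** a) by rewrite !rmulA.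
by rewrite xya // rmulNr opprK !rmulA addNr.
Qed.

End RngTheory.

Theorem theorem2 (R : rngType) (hR : semiprime R)
    (I : R -> Prop) (hI : nonzero_ideal I)
    (d g : R -> R) (hg : is_epimorphism g) (hg0 : nonzero_map g)
    (hd : multiplicative_semiderivation d g)
    (hanti : forall x y : R, I x -> I y -> d (jordan x y) = 0) :
  forall x : R, I x -> lie x (d x) = 0.
Proof.
move=> x Ix; have [idI _] := hI.
have lie0 : forall z y, I y -> lie x z ** y ** d x = 0.
  apply: (lie_mul_annihilator idI) => y Iy.
  exact: (jordan_mul_semider idI hd hanti).
apply: (semiprime_ideal_eq0 hR idI).
  by apply: (ridealB idI); [apply: ridealMr | apply: ridealMl].
(* Only the right-hand commutator is expanded: the term ending in [d x ** x] dies by [lie0] at [y],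
   the other by [lie0] at [y ** x]. *)
move=> y Iy; rewrite {2}/lie rmulBr (rmulA _ (d x) x) lie0 // rmul0l subr0.
have := lie0 (d x) (y ** x) (ridealMr idI x Iy).
by rewrite !rmulA.
Qed.
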